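(* Let problems (P) (the original delay-aware flow migration problem) and (Q) (its reformulation) and the post-processing procedure be as defined in the context, for arbitrary data of the kind described there. (i) Problem (Q) is a mixed integer quadratically constrained program whose objective function and all of whose constraints, except the rotated quadratic cone constraint $d_i^{rh}\pi_i^{rh}\ge c^2$ for all $(r,h)\in\mathcal V$, $i\in\mathcal I_h^{(r)}$, are linear in the decision variables. (ii) The optimality gap between (Q) and (P) is zero: the optimal values of (P) and (Q) coincide, and every optimal solution $(\boldsymbol x,\boldsymbol m,\boldsymbol\mu,\eta,\boldsymbol y,\boldsymbol d)$ of (P) is (when completed by suitable values of the auxiliary variables $\boldsymbol\gamma,\boldsymbol\xi,\boldsymbol\pi,c$) an optimal solution of (Q), either the unique one or one of several. (iii) Given an arbitrary optimal solution of (Q), the post-processing procedure outputs a tuple $(\boldsymbol x^{\ast},\boldsymbol m^{\ast},\boldsymbol\mu^{\ast},\eta^{\ast},\boldsymbol y^{\ast},\boldsymbol d^{\ast})$ that is an optimal solution of (P).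
   Context: **Data.** A finite set $\mathcal R$ of service requests (service function chains). For $r\in\mathcal R$: an integer $H_r\ge 1$, $\mathcal H_r=\{1,\dots,H_r\}$, a source $a^{(r)}$ and a destination $b^{(r)}$, a delay bound $D^{(r)}>0$, a traffic rate $\lambda^{(r)}\ge 0$, and a constant $\sigma^{(r)}\ge 0$ (data size per packet). $\mathcal V=\{(r,h): r\in\mathcal R,\ h\in\mathcal H_r\}$ indexes the virtual network functions (VNFs); each VNF has a type, and two VNFs of the same chain have different types. $L=\sum_{r\in\mathcal R}(H_r+1)$ is the total number of virtual links. A finite directed graph (without parallel edges) with node set $\mathcal I\cup\mathcal A$ ($\mathcal I$ and $\mathcal A$ disjoint) and edge set $\mathcal E$. $\mathcal I$ is the set of VNF instances, each having a type; $\mathcal A$ contains all $a^{(r)},b^{(r)}$. For $(r,h)\in\mathcal V$, $\mathcal I_h^{(r)}\subseteq\mathcal I$ is the set of instances of the same type as VNF $(r,h)$; for $i\in\mathcal I$, $\mathcal V_i=\{(r,h)\in\mathcal V: i\in\mathcal I_h^{(r)}\}$. Each $i\in\mathcal I$ has processing capacity $C_i>0$, and $P_i^{(r)}>0$ is the processing density of $i$ for $r$. Each edge $e\in\mathcal E$ has transmission capacity $C_e$. For $e\in\mathcal E$ and $i\in\mathcal I\cup\mathcal A$: $\beta_i^e=1$ if $i$ is the starting point of $e$ and $0$ otherwise; $\varphi_i^e=1$ if $i$ is the ending point of $e$ and $0$ otherwise. The previous mapping $\bar x_i^{rh}\in\{0,1\}$ ($(r,h)\in\mathcal V$, $i\in\mathcal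 I_h^{(r)}$) is given, with $\sum_{i\in\mathcal I_h^{(r)}}\bar x_i^{rh}=1$. Weights $\alpha_1,\alpha_2,\alpha_3\ge 0$ and a constant $0<\epsilon\ll 1$ are given. The time interval $t$ is fixed and omitted from the notation. **Problem (P).** Decision variables: $x_i^{rh}\in\{0,1\}$, $\mu_i^{rh}\ge 0$, $d_i^{rh}>0$ for $(r,h)\in\mathcal V$, $i\in\mathcal I_h^{(r)}$; $m_{i\to j}^{rh}\in\{0,1\}$ for $(r,h)\in\mathcal V$, $i,j\in\mathcal I_h^{(r)}$; $y_{ij}^{rh}\in\{0,1\}$ for $r\in\mathcal R$, $h\in\{0\}\cup\mathcal H_r$, $i,j\in\mathcal I\cup\mathcal A$; and $\eta\in\mathbb R$. Minimize $$O=\alpha_1\eta+\alpha_2\sum_{r\in\mathcal R}\sum_{h\in\mathcal H_r}\sum_{i,j\in\mathcal I_h^{(r)}}m_{i\to j}^{rh}+\alpha_3\Big[L-\sum_{r\in\mathcal R}\sum_{h\in\{0\}\cup\mathcal H_r}\sum_{i,j\in\mathcal I\cup\mathcal A}y_{ij}^{rh}\Big]$$ subject to: (1) $\sum_{i\in\mathcal I_h^{(r)}}x_i^{rh}=1$ for all $(r,h)\in\mathcal V$; (2) $m_{i\to j}^{rh}=\bar x_i^{rh}x_j^{rh}$ for $(r,h)\in\mathcal V$ and $i\ne j$ in $\mathcal I_h^{(r)}$, and $m_{i\to i}^{rh}=0$; (3) $x_i^{rh}\lambda^{(r)}\le\mu_i^{rh}\le x_i^{rh}C_i/P_i^{(r)}$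 for all $(r,h)\in\mathcal V$, $i\in\mathcal I_h^{(r)}$; (4) $\sum_{(r,h)\in\mathcal V_i}P_i^{(r)}\mu_i^{rh}\le\eta C_i$ for all $i\in\mathcal I$, and $0\le\eta\le1$; (5) $d_i^{rh}=\dfrac{1}{\mu_i^{rh}-x_i^{rh}\lambda^{(r)}+\epsilon}$ for all $(r,h)\in\mathcal V$, $i\in\mathcal I_h^{(r)}$; (6) $0<d_i^{rh}\le x_i^{rh}D^{(r)}+(1-x_i^{rh})\frac1\epsilon$ for all $(r,h)\in\mathcal V$, $i\in\mathcal I_h^{(r)}$; (7) $\sum_{h\in\mathcal H_r}\sum_{i\in\mathcal I_h^{(r)}}x_i^{rh}d_i^{rh}\le D^{(r)}$ for all $r\in\mathcal R$; (8a) $y_{ij}^{rh}=\sum_{e\in\mathcal E}\beta_i^e\varphi_j^e\,x_i^{rh}x_j^{r(h+1)}$ for $r\in\mathcal R$, $h\in\mathcal H_r\setminus\{H_r\}$, $i\in\mathcal I_h^{(r)}$, $j\in\mathcal I_{h+1}^{(r)}$; (8b) $y_{a^{(r)}j}^{r0}=\sum_{e\in\mathcal E}\beta_{a^{(r)}}^e\varphi_j^e\,x_j^{r1}$ for $r\in\mathcal R$, $j\in\mathcal I_1^{(r)}$; (8c) $y_{ib^{(r)}}^{rH_r}=\sum_{e\in\mathcal E}\beta_i^e\varphi_{b^{(r)}}^e\,x_i^{rH_r}$ for $r\in\mathcal R$, $i\in\mathcal I_{H_r}^{(r)}$; (8d) $y_{ij}^{rh}=0$ for all other index combinations; (9) $\sum_{r\in\mathcal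 R}\sum_{h\in\{0\}\cup\mathcal H_r}\sum_{i,j\in\mathcal I\cup\mathcal A}\beta_i^e\varphi_j^e\,y_{ij}^{rh}\lambda^{(r)}\sigma^{(r)}\le C_e$ for all $e\in\mathcal E$. **Problem (Q).** Same objective and same decision variables, plus auxiliary variables: $\gamma_i^{rh}\ge0$ and $\pi_i^{rh}\in\mathbb R$ for $(r,h)\in\mathcal V$, $i\in\mathcal I_h^{(r)}$; $\xi_{ij}^{rh}\in\{0,1\}$ for $r\in\mathcal R$, $h\in\mathcal H_r\setminus\{H_r\}$, $i\in\mathcal I_h^{(r)}$, $j\in\mathcal I_{h+1}^{(r)}$; and $c\in\mathbb R$. The constraints are (1), (2), (3), (4), (6), (8b), (8c), (8d), (9), with (5), (7), (8a) replaced as follows. (5') For all $(r,h)\in\mathcal V$, $i\in\mathcal I_h^{(r)}$: $\pi_i^{rh}=\mu_i^{rh}-x_i^{rh}\lambda^{(r)}+\epsilon$, $\ \pi_i^{rh}\ge\epsilon$, $\ d_i^{rh}\pi_i^{rh}\ge c^2$; and $c=1$. (7') $\sum_{h\in\mathcal H_r}\sum_{i\in\mathcal I_h^{(r)}}\gamma_i^{rh}\le D^{(r)}$ for all $r\in\mathcal R$; and for all $(r,h)\in\mathcal V$, $i\in\mathcal I_h^{(r)}$: $d_i^{rh}-\frac1\epsilon(1-x_i^{rh})\le\gamma_i^{rh}\le d_i^{rh}$ and $0\le\gamma_i^{rh}\le\frac1\epsilon x_i^{rh}$. (8a') For $r\in\mathcal R$, $h\in\mathcal H_r\setminus\{H_r\}$,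 $i\in\mathcal I_h^{(r)}$, $j\in\mathcal I_{h+1}^{(r)}$: $y_{ij}^{rh}=\sum_{e\in\mathcal E}\beta_i^e\varphi_j^e\,\xi_{ij}^{rh}$, $\ \xi_{ij}^{rh}\le x_i^{rh}$, $\ \xi_{ij}^{rh}\le x_j^{r(h+1)}$, $\ \xi_{ij}^{rh}\ge x_i^{rh}+x_j^{r(h+1)}-1$. **Post-processing procedure.** Input: an optimal solution of (Q), with components marked by $\star$. Initialize all output components (marked by $\ast$) to equal the corresponding $\star$ components. For every $(r,h)\in\mathcal V$ and $i\in\mathcal I_h^{(r)}$ with $d_i^{rh\,\star}\pi_i^{rh\,\star}>(c^\star)^2$ and $x_i^{rh\,\star}=1$: if $\alpha_1>0$, set $d_i^{rh\,\ast}=\dfrac{1}{\mu_i^{rh\,\star}-x_i^{rh\,\star}\lambda^{(r)}+\epsilon}$; if $\alpha_1=0$, set $\mu_i^{rh\,\ast}=\dfrac{1}{d_i^{rh\,\star}}+x_i^{rh\,\star}\lambda^{(r)}-\epsilon$. Finally, if $\alpha_1=0$, recompute $\eta^\ast=\max_{i\in\mathcal I}\frac{1}{C_i}\sum_{(r,h)\in\mathcal V_i}P_i^{(r)}\mu_i^{rh\,\ast}$. Output $(\boldsymbol x^\ast,\boldsymbol m^\ast,\boldsymbol\mu^\ast,\eta^\ast,\boldsymbol y^\ast,\boldsymbol d^\ast)$. *)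

(* Defs.v *)
From HB Require Import structures.
From mathcomp Require Import all_boot all_order all_algebra.
From mathcomp Require Import all_classical all_reals ereal.

Set Implicit Arguments.
Unset Strict Implicit.
Unset Printing Implicit Defensive.

Import Order.TTheory GRing.Theory Num.Theory.
Local Open Scope classical_set_scope.
Local Open Scope ring_scope.

(** A decision vector is a valuation [z : V -> R] of a finite type [V] of
variables.  Programs keep their constraints as syntactic objects (two sides
and a comparison), so that "this constraint is linear" is a statement about
the constraint itself and not about the feasible set. *)

Section Programs.
Variables (R : realType) (V : finType).
Implicit Types (f : (V -> R) -> R) (z : V -> R).

Inductive comparison := Le | Lt | Eq.

Record constr := Constr {
  lhs : (V -> R) -> R;
  cmp : comparison;
  rhs : (V -> R) -> R }.

Definition holds (k : constr) z : Prop :=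
  match cmp k with
  | Le => lhs k z <= rhs k z
  | Lt => lhs k z < rhs k z
  | Eq => lhs k z = rhs k z
  end.

(* A program is always a minimization; [binary v] means that the variable [v]
   ranges over {0, 1}, all other variables are real. *)
Record program := Program {
  objective : (V -> R) -> R;
  binary : pred V;
  constraints : set constr }.

Definition feasible (P : program) z : Prop :=
  (forall v, binary P v -> z v = 0 \/ z v = 1) /\
  (forall k, constraints P k -> holds k z).

Definition optimal (P : program) z : Prop :=
  feasible P z /\ forall z', feasible P z' -> objective P z <= objective P z'.

(* The value of an infeasible program is +oo. *)
Definition optimal_value (P : program) : \bar R :=
  ereal_inf [set (objective P z)%:E | z in feasible P].

(* "Linear" in the usual sense of mathematical programming: a constant term is
   allowed. *)
Definition linear_fun f : Prop :=
  exists (a0 : R) (a : V -> R), forall z, f z = a0 + \sum_v a v * z v.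

Definition quadratic_fun f : Prop :=
  exists (a0 : R) (a : V -> R) (A : V -> V -> R), forall z,
    f z = a0 + \sum_v a v * z v + \sum_u \sum_v A u v * (z u * z v).

Definition linear_constr (k : constr) : Prop :=
  linear_fun (lhs k) /\ linear_fun (rhs k).

Definition quadratic_constr (k : constr) : Prop :=
  quadratic_fun (lhs k) /\ quadratic_fun (rhs k).

(* Mixed integer quadratically constrained program; the integer variables are
   the binary ones. *)
Definition miqcp (P : program) : Prop :=
  [/\ finite_set (constraints P),
      quadratic_fun (objective P) &
      forall k, constraints P k -> quadratic_constr k].

Definition rotated_cone (u v w : R) : Prop :=
  [/\ 0 <= u, 0 <= v & w ^+ 2 <= u * v].

End Programs.

Record network := Network {
  request : finType;
  chain_len : request -> nat;
  chain_len_gt0 : forall r, (0 < chain_len r)%N;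
  inst : finType;
  access : finType;
  src : request -> access;
  dst : request -> access;
  vnf_kind : eqType;
  (* VNFs are numbered from 0: [h : 'I_(chain_len r)] is the (h+1)-st VNF. *)
  kind_of_vnf : forall r, 'I_(chain_len r) -> vnf_kind;
  kind_of_vnf_inj : forall r, injective (@kind_of_vnf r);
  kind_of_inst : inst -> vnf_kind;
  (* A directed edge is the pair (starting point, ending point). *)
  edges : {set (inst + access) * (inst + access)} }.

Section Indices.
Variable N : network.

Definition node : finType := (inst N + access N)%type.

Definition vnf : finType := {r : request N & 'I_(chain_len r)}.

Definition req_of (v : vnf) : request N := tag v.

Definition hosts (v : vnf) : {set inst N} :=
  [set i | kind_of_inst i == kind_of_vnf (tagged v)].

(* The index set of x, mu, d: pairs of a VNF (r, h) and an instance able to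
   host it. *)
Definition place : finType := {p : vnf * inst N | p.2 \in hosts p.1}.

Definition pvnf (p : place) : vnf := (val p).1.
Definition pinst (p : place) : inst N := (val p).2.
Definition preq (p : place) : request N := req_of (pvnf p).

(* The index set of m: two hosting instances (i, j) of one VNF (r, h). *)
Definition migr : finType := {pq : place * place | pvnf pq.1 == pvnf pq.2}.

Definition follows (v w : vnf) : bool :=
  (tag v == tag w) && (tagged w == (tagged v).+1 :> nat).

Definition is_first (v : vnf) : bool := tagged v == 0%N :> nat.
Definition is_last (v : vnf) : bool :=
  (tagged v).+1 == chain_len (tag v) :> nat.

(* The index set of xi: an instance for (r, h) and one for (r, h + 1). *)
Definition hop : finType :=
  {pq : place * place | follows (pvnf pq.1) (pvnf pq.2)}.

(* The virtual link [h <= chain_len r] of the chain r enters the VNF numbered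
   h from 0 and leaves the one numbered h - 1. *)
Definition vlink : finType := {r : request N & 'I_(chain_len r).+1}.

Definition link_in (v : vnf) : vlink :=
  Tagged (fun r : request N => 'I_(chain_len r).+1)
         (widen_ord (leqnSn _) (tagged v)).

Definition link_out (v : vnf) : vlink :=
  Tagged (fun r : request N => 'I_(chain_len r).+1) (lift ord0 (tagged v)).

(* The index set of y: (r, h) with 0 <= h <= chain_len r, and (i, j). *)
Definition flow : finType := (vlink * node * node)%type.

Definition hop_flow (g : hop) : flow :=
  (link_out (pvnf (val g).1), inl (pinst (val g).1), inl (pinst (val g).2)).

Definition src_flow (p : place) : flow :=
  (link_in (pvnf p), inr (src (preq p)), inl (pinst p)).

Definition dst_flow (p : place) : flow :=
  (link_out (pvnf p), inl (pinst p), inr (dst (preq p))).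

(* The index combinations not governed by the routing equations. *)
Definition idle_flow : set flow :=
  ~` (range hop_flow `|` src_flow @` [set p | is_first (pvnf p)]
                     `|` dst_flow @` [set p | is_last (pvnf p)]).

Inductive pvar :=
  | VX of place | VMu of place | VD of place | VM of migr | VY of flow | VEta.

Inductive qaux := VGam of place | VPi of place | VXi of hop | VC.

Definition pvar_code (u : pvar) : place + place + place + migr + flow + unit :=
  match u with
  | VX p => inl (inl (inl (inl (inl p))))
  | VMu p => inl (inl (inl (inl (inr p))))
  | VD p => inl (inl (inl (inr p)))
  | VM g => inl (inl (inr g))
  | VY f => inl (inr f)
  | VEta => inr tt
  end.

Definition pvar_decode (s : place + place + place + migr + flow + unit) :=
  match s with
  | inl (inl (inl (inl (inl p)))) => VX p
  | inl (inl (inl (inl (inr p)))) => VMu p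
  | inl (inl (inl (inr p))) => VD p
  | inl (inl (inr g)) => VM g
  | inl (inr f) => VY f
  | inr _ => VEta
  end.

Lemma pvar_codeK : cancel pvar_code pvar_decode.
Proof. by case. Qed.

HB.instance Definition _ := Finite.copy pvar (can_type pvar_codeK).

Definition qaux_code (u : qaux) : place + place + hop + unit :=
  match u with
  | VGam p => inl (inl (inl p))
  | VPi p => inl (inl (inr p))
  | VXi g => inl (inr g)
  | VC => inr tt
  end.

Definition qaux_decode (s : place + place + hop + unit) :=
  match s with
  | inl (inl (inl p)) => VGam p
  | inl (inl (inr p)) => VPi p
  | inl (inr g) => VXi g
  | inr _ => VC
  end.

Lemma qaux_codeK : cancel qaux_code qaux_decode.
Proof. by case. Qed.

HB.instance Definition _ := Finite.copy qaux (can_type qaux_codeK).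

Definition qvar : finType := (pvar + qaux)%type.

End Indices.

Arguments VEta {N}.
Arguments VC {N}.

Record sfc_data (R : realType) := SfcData {
  net :> network;
  delay : request net -> R;
  delay_gt0 : forall r, 0 < delay r;
  rate : request net -> R;
  rate_ge0 : forall r, 0 <= rate r;
  packet : request net -> R;
  packet_ge0 : forall r, 0 <= packet r;
  cap : inst net -> R;
  cap_gt0 : forall i, 0 < cap i;
  density : inst net -> request net -> R;
  density_gt0 : forall i r, 0 < density i r;
  (* Only the values on [edges net] matter. *)
  ecap : node net * node net -> R;
  prev : place net -> bool;
  prev_unique : forall v : vnf net, (\sum_(p | pvnf p == v) prev p = 1)%N;
  alpha1 : R;
  alpha2 : R;
  alpha3 : R;
  alpha1_ge0 : 0 <= alpha1;
  alpha2_ge0 : 0 <= alpha2;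
  alpha3_ge0 : 0 <= alpha3;
  epsilon : R;
  epsilon_gt0 : 0 < epsilon;
  epsilon_lt1 : epsilon < 1 }.

Section Problems.
Variables (R : realType) (D : sfc_data R).
Implicit Types (z : pvar D -> R) (w : qvar D -> R).

Local Notation eps := (epsilon D).

Definition beta (i : node D) (e : node D * node D) : R := (e.1 == i)%:R.
Definition phi (i : node D) (e : node D * node D) : R := (e.2 == i)%:R.

Definition adj (i j : node D) : R := \sum_(e in edges D) beta i e * phi j e.

Definition nlinks : nat := (\sum_(r : request D) (chain_len r).+1)%N.

Definition cost z : R :=
  alpha1 D * z VEta
  + alpha2 D * \sum_(g : migr D) z (VM g)
  + alpha3 D * (nlinks%:R - \sum_(f : flow D) z (VY f)).

Definition p_binary (u : pvar D) : bool :=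
  match u with VX _ | VM _ | VY _ => true | _ => false end.

Notation con := (constr R (pvar D)).

Definition mu_nonneg (p : place D) : con :=
  Constr (fun=> 0) Le (fun z => z (VMu p)).

Definition assign (v : vnf D) : con :=
  Constr (fun z => \sum_(p | pvnf p == v) z (VX p)) Eq (fun=> 1).

Definition migration (g : migr D) : con :=
  Constr (fun z => z (VM g)) Eq
         (fun z => if pinst (val g).1 == pinst (val g).2 then 0
                   else (prev (val g).1)%:R * z (VX (val g).2)).

Definition rate_lower (p : place D) : con :=
  Constr (fun z => z (VX p) * rate (preq p)) Le (fun z => z (VMu p)).

Definition rate_upper (p : place D) : con :=
  Constr (fun z => z (VMu p)) Le
         (fun z => z (VX p) * (cap (pinst p) / density (pinst p) (preq p))).

Definition load (i : inst D) (mu : place D -> R) : R :=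
  \sum_(p : place D | pinst p == i) density i (preq p) * mu p.

Definition capacity (i : inst D) : con :=
  Constr (fun z => load i (fun p => z (VMu p))) Le
         (fun z => z VEta * cap i).

Definition eta_lower : con := Constr (fun=> 0) Le (fun z => z VEta).
Definition eta_upper : con := Constr (fun z => z VEta) Le (fun=> 1).

Definition d_positive (p : place D) : con :=
  Constr (fun=> 0) Lt (fun z => z (VD p)).

Definition d_upper (p : place D) : con :=
  Constr (fun z => z (VD p)) Le
         (fun z => z (VX p) * delay (preq p) + (1 - z (VX p)) * eps^-1).

Definition route_src (p : place D) : con :=
  Constr (fun z => z (VY (src_flow p))) Eq
         (fun z => adj (inr (src (preq p))) (inl (pinst p)) * z (VX p)).

Definition route_dst (p : place D) : con :=
  Constr (fun z => z (VY (dst_flow p))) Eq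
         (fun z => adj (inl (pinst p)) (inr (dst (preq p))) * z (VX p)).

Definition route_idle (f : flow D) : con :=
  Constr (fun z => z (VY f)) Eq (fun=> 0).

Definition edge_capacity (e : node D * node D) : con :=
  Constr (fun z => \sum_(f : flow D)
            beta f.1.2 e * phi f.2 e * z (VY f)
            * rate (tag f.1.1) * packet (tag f.1.1)) Le
         (fun=> ecap e).

Definition common_constraints : set con :=
  range mu_nonneg
  `|` range assign
  `|` range migration
  `|` range rate_lower `|` range rate_upper
  `|` range capacity `|` [set eta_lower] `|` [set eta_upper]
  `|` range d_positive `|` range d_upper
  `|` route_src @` [set p | is_first (pvnf p)]
  `|` route_dst @` [set p | is_last (pvnf p)]
  `|` route_idle @` @idle_flow D
  `|` edge_capacity @` [set e | e \in edges D].

Definition delay_def (p : place D) : con :=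
  Constr (fun z => z (VD p)) Eq
         (fun z => (z (VMu p) - z (VX p) * rate (preq p) + eps)^-1).

Definition chain_delay (r : request D) : con :=
  Constr (fun z => \sum_(p : place D | preq p == r) z (VX p) * z (VD p)) Le
         (fun=> delay r).

Definition route_hop (g : hop D) : con :=
  Constr (fun z => z (VY (hop_flow g))) Eq
         (fun z => adj (inl (pinst (val g).1)) (inl (pinst (val g).2))
                   * z (VX (val g).1) * z (VX (val g).2)).

Definition problemP : program R (pvar D) :=
  Program cost p_binary
    (common_constraints `|` range delay_def `|` range chain_delay
                        `|` range route_hop).

Definition restrict w : pvar D -> R := fun u => w (inl u).

Definition extend z (a : qaux D -> R) : qvar D -> R :=
  fun t => match t with inl u => z u | inr u => a u end.

Definition lift_constr (k : con) : constr R (qvar D) :=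
  Constr (fun w => lhs k (restrict w)) (cmp k) (fun w => rhs k (restrict w)).

Definition q_binary (t : qvar D) : bool :=
  match t with
  | inl u => p_binary u
  | inr (VXi _) => true
  | inr _ => false
  end.

Notation qcon := (constr R (qvar D)).
Notation "w .[X p ]" := (w (inl (VX p))) (at level 2, p at level 200).
Notation "w .[Mu p ]" := (w (inl (VMu p))) (at level 2, p at level 200).
Notation "w .[D p ]" := (w (inl (VD p))) (at level 2, p at level 200).
Notation "w .[Y f ]" := (w (inl (VY f))) (at level 2, f at level 200).
Notation "w .[Gam p ]" := (w (inr (VGam p))) (at level 2, p at level 200).
Notation "w .[Pi p ]" := (w (inr (VPi p))) (at level 2, p at level 200).
Notation "w .[Xi g ]" := (w (inr (VXi g))) (at level 2, g at level 200).

Definition pi_def (p : place D) : qcon :=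
  Constr (fun w => w.[Pi p]) Eq
         (fun w => w.[Mu p] - w.[X p] * rate (preq p) + eps).

Definition pi_lower (p : place D) : qcon :=
  Constr (fun=> eps) Le (fun w => w.[Pi p]).

Definition cone_constr (p : place D) : qcon :=
  Constr (fun w => w (inr VC) ^+ 2) Le (fun w => w.[D p] * w.[Pi p]).

Definition c_def : qcon := Constr (fun w => w (inr VC)) Eq (fun=> 1).

Definition q_chain_delay (r : request D) : qcon :=
  Constr (fun w => \sum_(p : place D | preq p == r) w.[Gam p]) Le
         (fun=> delay r).

Definition gam_lower (p : place D) : qcon :=
  Constr (fun w => w.[D p] - eps^-1 * (1 - w.[X p])) Le
         (fun w => w.[Gam p]).

Definition gam_upper (p : place D) : qcon :=
  Constr (fun w => w.[Gam p]) Le (fun w => w.[D p]).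

Definition gam_nonneg (p : place D) : qcon :=
  Constr (fun=> 0) Le (fun w => w.[Gam p]).

Definition gam_switch (p : place D) : qcon :=
  Constr (fun w => w.[Gam p]) Le (fun w => eps^-1 * w.[X p]).

Definition q_route_hop (g : hop D) : qcon :=
  Constr (fun w => w.[Y (hop_flow g)]) Eq
         (fun w => adj (inl (pinst (val g).1)) (inl (pinst (val g).2))
                   * w.[Xi g]).

Definition xi_upper1 (g : hop D) : qcon :=
  Constr (fun w => w.[Xi g]) Le (fun w => w.[X (val g).1]).

Definition xi_upper2 (g : hop D) : qcon :=
  Constr (fun w => w.[Xi g]) Le (fun w => w.[X (val g).2]).

Definition xi_lower (g : hop D) : qcon :=
  Constr (fun w => w.[X (val g).1] + w.[X (val g).2] - 1) Le
         (fun w => w.[Xi g]).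

Definition problemQ : program R (qvar D) :=
  Program (fun w => cost (restrict w)) q_binary
    (lift_constr @` common_constraints
     `|` range pi_def `|` range pi_lower `|` range cone_constr `|` [set c_def]
     `|` range q_chain_delay `|` range gam_lower `|` range gam_upper
     `|` range gam_nonneg `|` range gam_switch
     `|` range q_route_hop `|` range xi_upper1 `|` range xi_upper2
     `|` range xi_lower).

Definition slack w (p : place D) : bool :=
  (w (inr VC) ^+ 2 < w.[D p] * w.[Pi p]) && (w.[X p] == 1).

Definition post_mu w (p : place D) : R :=
  if slack w p && (alpha1 D == 0)
  then (w.[D p])^-1 + w.[X p] * rate (preq p) - eps
  else w.[Mu p].

Definition post_d w (p : place D) : R :=
  if slack w p && (0 < alpha1 D)
  then (w.[Mu p] - w.[X p] * rate (preq p) + eps)^-1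
  else w.[D p].

(* The maximum is taken over nonnegative quantities; its default value 0 only
   matters when there is no instance at all. *)
Definition post_eta w : R :=
  if alpha1 D == 0
  then \big[Num.max/0]_(i : inst D) ((cap i)^-1 * load i (post_mu w))
  else w (inl VEta).

Definition post_process w : pvar D -> R :=
  fun u => match u with
  | VMu p => post_mu w p
  | VD p => post_d w p
  | VEta => post_eta w
  | _ => w (inl u)
  end.

End Problems.

(* Main.v *)
Require Import Defs.
From HB Require Import structures.
From mathcomp Require Import all_boot all_order all_algebra.
From mathcomp Require Import all_classical all_reals ereal.

Set Implicit Arguments.
Unset Strict Implicit.
Unset Printing Implicit Defensive.

Import Order.TTheory GRing.Theory Num.Theory.
Local Open Scope classical_set_scope.
Local Open Scope ring_scope.

(** A feasible point of (P) extends to one of (Q) of the same cost by taking the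
auxiliary variables at their defining values.  Conversely, in (Q) the variables
xi are forced to be the products of the x, and d can differ from 1/pi only on an
active place (x = 1) with a strict cone inequality.  There post-processing
either decreases d to 1/pi, or, when eta has no weight, decreases mu so that
pi = 1/d; both changes go in the harmless direction for all other constraints
and leave the cost unchanged.  Feasibility and cost being preserved in both
directions, optimality is preserved too. *)

(** * Closure properties of linear and quadratic functions *)

Section LinearFunctions.
Variables (R : realType) (V : finType).
Implicit Types (f g : (V -> R) -> R).

Lemma linear_fun_cst (c : R) : linear_fun (fun _ : V -> R => c).
Proof.
exists c, (fun=> 0) => z; rewrite big1 ?addr0 // => v _; exact: mul0r.
Qed.

Lemma linear_fun_var (v : V) : linear_fun (fun z : V -> R => z v).
Proof.
exists 0, (fun u => (u == v)%:R) => z.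
rewrite add0r (bigD1 v) //= eqxx mul1r big1 ?addr0 // => u /negPf ->.
exact: mul0r.
Qed.

Lemma linear_funD f g :
  linear_fun f -> linear_fun g -> linear_fun (fun z => f z + g z).
Proof.
move=> [a0 [a fE]] [b0 [b gE]]; exists (a0 + b0), (fun v => a v + b v) => z.
rewrite fE gE addrACA -big_split; congr (_ + _).
by apply: eq_bigr => v _; rewrite mulrDl.
Qed.

Lemma linear_funMl (c : R) f : linear_fun f -> linear_fun (fun z => c * f z).
Proof.
move=> [a0 [a fE]]; exists (c * a0), (fun v => c * a v) => z.
rewrite fE mulrDr mulr_sumr; congr (_ + _).
by apply: eq_bigr => v _; rewrite mulrA.
Qed.

Lemma linear_funMr (c : R) f : linear_fun f -> linear_fun (fun z => f z * c).
Proof.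
move=> /(linear_funMl c) [a0 [a fE]]; exists a0, a => z.
by rewrite mulrC fE.
Qed.

Lemma linear_funN f : linear_fun f -> linear_fun (fun z => - f z).
Proof.
move=> /(linear_funMl (-1)) [a0 [a fE]]; exists a0, a => z.
by rewrite -mulN1r fE.
Qed.

Lemma linear_fun_if (b : bool) f g :
  linear_fun f -> linear_fun g -> linear_fun (fun z => if b then f z else g z).
Proof. by case: b. Qed.

Lemma linear_fun_sum (I : Type) (r : seq I) (P : pred I)
    (F : I -> (V -> R) -> R) :
  (forall i, linear_fun (F i)) ->
  linear_fun (fun z => \sum_(i <- r | P i) F i z).
Proof.
move=> FL; elim: r => [|i r IHr].
  have [a0 [a E]] := linear_fun_cst 0.
  by exists a0, a => z; rewrite big_nil.
(* Moving the filter [P] into the summand lets one linear form serve both outcomes of the test. *)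
have [a0 [a E]] : linear_fun (fun z =>
    (if P i then F i z else 0) + \sum_(j <- r | P j) F j z).
  by apply: linear_funD IHr; apply: linear_fun_if (linear_fun_cst 0).
by exists a0, a => z; rewrite big_cons -E; case: (P i); rewrite ?add0r.
Qed.

Lemma quadratic_linear f : linear_fun f -> quadratic_fun f.
Proof.
move=> [a0 [a fE]]; exists a0, a, (fun _ _ => 0) => z.
rewrite fE [X in _ = _ + X]big1 ?addr0 // => u _.
by rewrite big1 // => v _; rewrite mul0r.
Qed.

Lemma quadratic_mul (u v : V) : quadratic_fun (fun z : V -> R => z u * z v).
Proof.
exists 0, (fun=> 0), (fun s t => ((s == u) && (t == v))%:R) => z.
rewrite big1 => [|s _]; last exact: mul0r.
rewrite !add0r (bigD1 u) //= (bigD1 v) //= !eqxx mul1r.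
rewrite big1 => [|t /negPf ->]; last by rewrite andbF mul0r.
rewrite big1 ?addr0 // => s /negPf ->.
by rewrite big1 // => t _; rewrite mul0r.
Qed.

Lemma quadratic_linear_constr (k : constr R V) :
  linear_constr k -> quadratic_constr k.
Proof. by move=> [? ?]; split; apply: quadratic_linear. Qed.

End LinearFunctions.

(** * Tactics for linearity and for nested unions of constraint sets *)

Ltac linear_tac :=
  repeat first
    [ exact: linear_fun_cst | exact: linear_fun_var
    | apply: linear_funD | apply: linear_funN
    | apply: linear_funMl | apply: linear_funMr
    | apply: linear_fun_if | apply: linear_fun_sum => ? ].

Ltac split_conj := repeat match goal with |- _ /\ _ => split end.

(** Searches the union tree with backtracking. At an image, [reflexivity] comes first, so that
    unification finds the index. *)
Ltac in_union :=
  first [ by [] | eexists; [| reflexivity]; in_union | right; in_union | left; in_union ].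

Ltac by_component :=
  first [ move=> _ [? ? <-] | move=> _ -> ];
  by match goal with H : _ |- _ => apply: H end.

Section Reformulation.
Variables (R : realType) (D : sfc_data R).
Implicit Types (z : pvar D -> R) (w : qvar D -> R).
Local Notation eps := (epsilon D).

(** * The algebraic form of (Q) *)

Lemma linear_fun_restrict (f : (pvar D -> R) -> R) :
  linear_fun f -> linear_fun (fun w => f (Defs.restrict w)).
Proof.
move=> [a0 [a fE]].
have [b0 [b E]] : linear_fun (fun w => a0 + \sum_v a v * w (inl v)).
  by linear_tac.
by exists b0, b => w; rewrite fE -E.
Qed.

Lemma linear_cost : linear_fun (@cost R D).
Proof. by rewrite /cost; linear_tac. Qed.

Lemma common_linear : @common_constraints R D `<=` @linear_constr R (pvar D).
Proof.
rewrite /common_constraints !subUset; split_conj;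
  first [move=> _ [p _ <-] | move=> _ ->]; split => /=; rewrite /load;
  by linear_tac.
Qed.

Lemma problemQ_linear_or_cone :
  constraints (problemQ D) `<=`
  [set k | linear_constr k] `|` range (@cone_constr R D).
Proof.
rewrite /problemQ /= !subUset; split_conj.
  move=> _ [k /common_linear[kl kr] <-]; left.
  by split; apply: linear_fun_restrict.
all: first [move=> _ [p _ <-] | move=> _ ->].
all: first [ by right; exists p | by left; split => /=; linear_tac ].
Qed.

Lemma problemQ_quadratic : constraints (problemQ D) `<=` @quadratic_constr R _.
Proof.
move=> k /problemQ_linear_or_cone[/quadratic_linear_constr //|[p _ <-]].
(* The square of [VC] unfolds to a product of two variables, so both sides have the same shape. *)
by split; exact: quadratic_mul.
Qed.

Lemma problemQ_finite : finite_set (constraints (problemQ D)).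
Proof.
have fin (I : finType) T (f : I -> T) (A : set I) : finite_set (f @` A).
  exact/finite_image/finite_finset.
have common_fin : finite_set (@common_constraints R D).
  rewrite /common_constraints !finite_setU; split_conj; 
    first [exact: fin|exact: finite_set1].
rewrite /problemQ /= !finite_setU; split_conj;
  first [exact: fin|exact: finite_set1|exact: finite_image].
Qed.

(* The strict positivity of d and the bound pi >= eps are not of the form
   c^2 <= d * pi, so they are still available once the cone constraints have
   been removed. *)
Lemma problemQ_cone (p : place D) w :
  (forall k, (constraints (problemQ D) `\` range (@cone_constr R D)) k ->
     holds k w) ->
  holds (cone_constr p) w <->
  rotated_cone (w (inl (VD p))) (w (inr (VPi p))) (w (inr VC)).
Proof.
move=> wP; split=> [cone|[]//]; split=> //.
  (* Being strict ([Lt]), this constraint differs syntactically from every cone constraint. *)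
  apply/ltW/(wP (lift_constr (d_positive p))); split; last by case.
  by in_union.
apply: (le_trans (ltW (epsilon_gt0 D))); apply: (wP (pi_lower p)).
split; first by in_union.
(* [pi_lower] is no cone constraint: at the zero valuation its left side is [eps], that of a cone is
   0. *)
case=> q _ /(congr1 (fun k => lhs k (fun=> 0))) /= /eqP.
by rewrite expr0n /= lt_eqF // epsilon_gt0.
Qed.

(** * Feasibility, one constraint family at a time *)

Record common_feasible z : Prop := CommonFeasible {
  cf_mu_nonneg : forall p, holds (@mu_nonneg R D p) z;
  cf_assign : forall v, holds (@assign R D v) z;
  cf_migration : forall g, holds (migration g) z;
  cf_rate_lower : forall p, holds (rate_lower p) z;
  cf_rate_upper : forall p, holds (rate_upper p) z;
  cf_capacity : forall i, holds (capacity i) z;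
  cf_eta_lower : holds (eta_lower D) z;
  cf_eta_upper : holds (eta_upper D) z;
  cf_d_positive : forall p, holds (d_positive p) z;
  cf_d_upper : forall p, holds (d_upper p) z;
  cf_route_src : forall p, is_first (pvnf p) -> holds (@route_src R D p) z;
  cf_route_dst : forall p, is_last (pvnf p) -> holds (@route_dst R D p) z;
  cf_route_idle : forall f, idle_flow f -> holds (@route_idle R D f) z;
  cf_edge_capacity : forall e, e \in edges D -> holds (edge_capacity e) z }.

(** Trades the nested union for named fields, so that later proofs can cite a constraint by name. *)
Lemma common_feasibleP z :
  @common_constraints R D `<=` [set k | holds k z] <-> common_feasible z.
Proof.
split=> [sub|[]].
  have {}sub k : common_constraints k -> holds k z by exact: sub.
  by split; intros; apply: sub; in_union.
rewrite /common_constraints !subUset => *; split_conj.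
all: by_component.
Qed.

Record problemP_feasible z : Prop := ProblemPFeasible {
  pf_binary : forall u, p_binary u -> z u = 0 \/ z u = 1;
  pf_common : common_feasible z;
  pf_delay_def : forall p, holds (delay_def p) z;
  pf_chain_delay : forall r, holds (chain_delay r) z;
  pf_route_hop : forall g, holds (@route_hop R D g) z }.

Lemma problemP_feasibleP z : feasible (problemP D) z <-> problemP_feasible z.
Proof.
split=> [[zb zk]|[zb /common_feasibleP zc zd zr zh]].
  split=> //; last 3 first.
  - by move=> p; apply: zk; in_union.
  - by move=> r; apply: zk; in_union.
  - by move=> g; apply: zk; in_union.
  by apply/common_feasibleP => k kc; apply: zk; do 3 left.
split=> //.
suff: constraints (problemP D) `<=` [set k | holds k z] by [].
rewrite /problemP /= 3!subUset; split_conj => //.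
all: by_component.
Qed.

Record problemQ_feasible w : Prop := ProblemQFeasible {
  qf_binary : forall u, q_binary u -> w u = 0 \/ w u = 1;
  qf_common : common_feasible (Defs.restrict w);
  qf_pi_def : forall p, holds (pi_def p) w;
  qf_pi_lower : forall p, holds (pi_lower p) w;
  qf_cone : forall p, holds (@cone_constr R D p) w;
  qf_c_def : holds (c_def D) w;
  qf_chain_delay : forall r, holds (q_chain_delay r) w;
  qf_gam_lower : forall p, holds (gam_lower p) w;
  qf_gam_upper : forall p, holds (@gam_upper R D p) w;
  qf_gam_nonneg : forall p, holds (@gam_nonneg R D p) w;
  qf_gam_switch : forall p, holds (gam_switch p) w;
  qf_route_hop : forall g, holds (@q_route_hop R D g) w;
  qf_xi_upper1 : forall g, holds (@xi_upper1 R D g) w;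
  qf_xi_upper2 : forall g, holds (@xi_upper2 R D g) w;
  qf_xi_lower : forall g, holds (@xi_lower R D g) w }.

Lemma problemQ_feasibleP w : feasible (problemQ D) w <-> problemQ_feasible w.
Proof.
split=> [[wb wk]|[wb /common_feasibleP wc *]].
  have wc : common_feasible (Defs.restrict w).
    apply/common_feasibleP => k kc; apply: (wk (lift_constr k)).
    (* The lifted common constraints are the leftmost of the 14 sets in the union. *)
    by do 13 left; exists k.
  by split=> //; intros; apply: wk; in_union.
split=> //.
suff: constraints (problemQ D) `<=` [set k | holds k w] by [].
rewrite /problemQ /= !subUset; split_conj => //.
  by move=> _ [k /wc kz <-].
all: by_component.
Qed.

(** * From (P) to (Q) *)

Definition aux_of z : qaux D -> R := fun t => match t with
  | VGam p => z (VX p) * z (VD p)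
  | VPi p => z (VMu p) - z (VX p) * rate (preq p) + eps
  | VXi g => z (VX (val g).1) * z (VX (val g).2)
  | VC => 1
  end.

(** For binary x the constraints of (Q) leave no other choice than [aux_of]. The cones hold with
    equality because d is the inverse of pi. *)
Lemma extend_feasible z :
  feasible (problemP D) z -> feasible (problemQ D) (extend z (aux_of z)).
Proof.
move=> /problemP_feasibleP[zb zc zd zr zh]; apply/problemQ_feasibleP.
have zx p : z (VX p) = 0 \/ z (VX p) = 1 by apply: zb.
have pi_ge p : eps <= z (VMu p) - z (VX p) * rate (preq p) + eps.
  by rewrite lerDr subr_ge0; exact: (cf_rate_lower zc).
have pi_gt0 p : 0 < z (VMu p) - z (VX p) * rate (preq p) + eps.
  exact: lt_le_trans (epsilon_gt0 D) (pi_ge p).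
have d_gt0 p : 0 < z (VD p) by exact: (cf_d_positive zc).
have dE p : z (VD p) = (z (VMu p) - z (VX p) * rate (preq p) + eps)^-1.
  exact: zd.
(* This makes 1/eps a valid big-M constant: it gives [gam_lower] when x = 0 and [gam_switch] when x
   = 1. *)
have d_le p : z (VD p) <= eps^-1.
  by rewrite dE lef_pV2 ?posrE ?epsilon_gt0.
split=> //; rewrite /holds /=.
- case=> [u|[]//] /=; first exact: zb.
  move=> g _; have [->|->] := zx (val g).1; first by left; rewrite mul0r.
  by rewrite mul1r; exact: zx.
- by move=> p; rewrite dE mulVf ?expr1n ?gt_eqF.
- move=> p; have [->|->] := zx p; first by rewrite subr0 mulr1 mul0r subr_le0.
  by rewrite subrr mulr0 subr0 mul1r.
- by move=> p; have [->|->] := zx p; rewrite ?mul0r ?mul1r // ltW.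
- by move=> p; have [->|->] := zx p; rewrite ?mul0r ?mul1r // ltW.
- by move=> p; have [->|->] := zx p; rewrite ?mul0r ?mul1r ?mulr0 ?mulr1.
- by move=> g; rewrite mulrA; exact: zh.
- move=> g; have [->|->] := zx (val g).1; rewrite ?mul0r ?mul1r //.
  by have [->|->] := zx (val g).2.
- move=> g; have [->|->] := zx (val g).1; rewrite ?mul0r ?mul1r //.
  by have [->|->] := zx (val g).2.
- move=> g; have [->|->] := zx (val g).1; rewrite ?mul0r ?mul1r.
    by have [->|->] := zx (val g).2; rewrite add0r ?sub0r ?subrr ?lerN10.
  by rewrite addrAC subrr add0r.
Qed.

(** * From (Q) back to (P) by post-processing *)

Lemma load_le (i : inst D) (mu nu : place D -> R) :
  (forall p, mu p <= nu p) -> load i mu <= load i nu.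
Proof.
by move=> le; apply: ler_sum => p _; rewrite ler_wpM2l // ltW ?density_gt0.
Qed.

(** Among the variables in the cost only [VEta] can change, and only when its weight is 0. *)
Lemma cost_post_process w : cost (post_process w) = cost (Defs.restrict w).
Proof.
rewrite /cost /=; congr (_ + _ + _).
by rewrite /post_eta; case: eqP => // ->; rewrite !mul0r.
Qed.

Section PostProcess.
Variable w : qvar D -> R.
Hypothesis wP : problemQ_feasible w.
Let zc : common_feasible (Defs.restrict w) := qf_common wP.

Local Notation X p := (w (inl (VX p))).
Local Notation d p := (w (inl (VD p))).
Local Notation mu p := (w (inl (VMu p))).
Local Notation excess p := (mu p - X p * rate (preq p) + eps).

Lemma place_binary p : X p = 0 \/ X p = 1.
Proof. by apply: (qf_binary wP). Qed.

Lemma delay_gt0 p : 0 < d p. Proof. exact: (cf_d_positive zc). Qed.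

Lemma piE p : w (inr (VPi p)) = excess p. Proof. exact: (qf_pi_def wP). Qed.

Lemma cE : w (inr VC) = 1. Proof. exact: (qf_c_def wP). Qed.

Lemma excess_gt0 p : 0 < excess p.
Proof.
apply: (lt_le_trans (epsilon_gt0 D)).
by rewrite -piE; exact: (qf_pi_lower wP p).
Qed.

Lemma cone_ge1 p : 1 <= d p * excess p.
Proof.
by have := qf_cone wP p; rewrite /holds /= cE piE expr1n.
Qed.

(* On an idle place mu = 0, hence pi = eps, and the cone meets the upper bound
   1/eps on d; the only places left to repair are thus the slack ones. *)
Lemma not_slack p : ~~ slack w p -> d p = (excess p)^-1.
Proof.
have e0 := epsilon_gt0 D.
suff dE : ~~ slack w p -> d p * excess p <= 1.
  move=> /dE le1; apply: (@mulIf _ (excess p)); first by rewrite gt_eqF ?excess_gt0.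
  by rewrite mulVf ?gt_eqF ?excess_gt0 //; apply/le_anti; rewrite le1 cone_ge1.
rewrite /slack cE piE expr1n.
have [X0|->] := place_binary p; last by rewrite eqxx andbT -leNgt.
have muE : mu p = 0.
  apply/le_anti; rewrite [0 <= _](cf_mu_nonneg zc p) andbT.
  by have := cf_rate_upper zc p; rewrite /holds /= /Defs.restrict X0 mul0r.
have := cf_d_upper zc p; rewrite /holds /= /Defs.restrict X0 muE.
by rewrite !mul0r !subr0 !add0r mul1r -ler_pdivlMr // mul1r.
Qed.

(** On an active place [d_upper] gives only the delay bound, which is not compared with 1/eps; there
    the bound passes through gamma, by [gam_lower] and [gam_switch]. It keeps the lowered mu above
    the traffic rate. *)
Lemma delay_le p : d p <= eps^-1.
Proof.
have [X0|X1] := place_binary p.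
  have := cf_d_upper zc p; rewrite /holds /= /Defs.restrict X0.
  by rewrite mul0r add0r subr0 mul1r.
have := le_trans (qf_gam_lower wP p) (qf_gam_switch wP p).
by rewrite /= X1 subrr mulr0 subr0 mulr1.
Qed.

(** By the cone the old excess is at least 1/d, and a lowered mu has excess exactly 1/d. *)
Lemma post_mu_le p : post_mu w p <= mu p.
Proof.
rewrite /post_mu; case: ifP => // _.
rewrite lerBlDr -lerBrDr addrAC -[(d p)^-1]mul1r ler_pdivrMr ?delay_gt0 //.
by rewrite mulrC cone_ge1.
Qed.

Lemma rate_le_post_mu p : X p * rate (preq p) <= post_mu w p.
Proof.
rewrite /post_mu; case: ifP => _; last exact: (cf_rate_lower zc).
rewrite addrAC lerDr subr_ge0 -[leLHS]invrK.
by rewrite lef_pV2 ?posrE ?invr_gt0 ?epsilon_gt0 ?delay_gt0 // delay_le.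
Qed.

Lemma post_d_gt0 p : 0 < post_d w p.
Proof.
by rewrite /post_d; case: ifP => _; rewrite ?invr_gt0 ?excess_gt0 ?delay_gt0.
Qed.

Lemma post_d_le p : post_d w p <= d p.
Proof.
rewrite /post_d; case: ifP => // _.
by rewrite -[leLHS]mul1r ler_pdivrMr ?excess_gt0 // cone_ge1.
Qed.

Lemma post_dE p :
  post_d w p = (post_mu w p - X p * rate (preq p) + eps)^-1.
Proof.
rewrite /post_d /post_mu.
have [s|/not_slack dE] /= := boolP (slack w p); last by [].
(* Since [alpha1] is nonnegative, exactly one of mu and d is repaired on a slack place. *)
have := alpha1_ge0 D; rewrite le_eqVlt eq_sym; case: eqP => /= [->|_ ->//].
by rewrite ltxx (addrAC _ (- eps)) addrK subrK invrK.
Qed.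

(** Loads only decrease with mu, so the old eta still dominates them, whether it is kept or replaced
    by their maximum. *)
Lemma post_load_le (i : inst D) :
  (cap i)^-1 * load i (post_mu w) <= w (inl VEta).
Proof.
rewrite ler_pdivrMl ?cap_gt0 // mulrC.
exact: le_trans (load_le i post_mu_le) (cf_capacity zc i).
Qed.

Lemma post_eta_le : post_eta w <= w (inl VEta).
Proof.
rewrite /post_eta; case: ifP => // _.
(* The default value 0 of the maximum needs a bound too, namely [eta_lower]. *)
by apply: bigmax_le => [|i _]; [exact: (cf_eta_lower zc)|exact: post_load_le].
Qed.

Lemma post_eta_ge0 : 0 <= post_eta w.
Proof.
rewrite /post_eta; case: ifP => _; last exact: (cf_eta_lower zc).
exact: bigmax_ge_id.
Qed.

Lemma post_capacity (i : inst D) : load i (post_mu w) <= post_eta w * cap i.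
Proof.
rewrite mulrC -ler_pdivrMl ?cap_gt0 // /post_eta; case: ifP => _.
  exact: (le_bigmax_cond _ (fun i : inst D => (cap i)^-1 * load i (post_mu w))).
exact: post_load_le.
Qed.

Lemma post_common_feasible : common_feasible (post_process w).
Proof.
(* Post-processing keeps x, m and y, so constraints on these alone are inherited. *)
split; rewrite /holds /=; try by case: zc.
- move=> p; apply: le_trans (rate_le_post_mu p).
  by rewrite mulr_ge0 ?rate_ge0 //; have [->|->] := place_binary p.
- exact: rate_le_post_mu.
- by move=> p; apply: le_trans (post_mu_le p) (cf_rate_upper zc p).
- exact: post_capacity.
- exact: post_eta_ge0.
- exact: le_trans post_eta_le (cf_eta_upper zc).
- exact: post_d_gt0.
- by move=> p; apply: le_trans (post_d_le p) (cf_d_upper zc p).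
Qed.

(** Each term is at most gamma: by [gam_nonneg] on an idle place, by [gam_lower] on an active
    one. *)
Lemma post_chain_delay (r : request D) :
  \sum_(p : place D | preq p == r) X p * post_d w p <= delay r.
Proof.
apply: le_trans (qf_chain_delay wP r); apply: ler_sum => p _ /=.
have [X0|X1] := place_binary p.
  by rewrite X0 mul0r; exact: (qf_gam_nonneg wP).
rewrite X1 mul1r; apply: (le_trans (post_d_le p)).
by have := qf_gam_lower wP p; rewrite /holds /= X1 subrr mulr0 subr0.
Qed.

(** The three inequalities on xi belong to the McCormick envelope of a product of binaries; the
    missing bound 0 comes from xi being binary. *)
Lemma xiE (g : hop D) : w (inr (VXi g)) = X (val g).1 * X (val g).2.
Proof.
have := (qf_xi_upper1 wP g, qf_xi_upper2 wP g, qf_xi_lower wP g).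
rewrite /holds /= => -[[le1 le2]].
have xib : w (inr (VXi g)) = 0 \/ w (inr (VXi g)) = 1 by apply: (qf_binary wP).
move: le1 le2; have [->|->] := place_binary (val g).1.
  by rewrite mul0r; case: xib => -> //; rewrite ler10.
rewrite mul1r addrAC subrr add0r => _ le2 ge2.
by apply/le_anti; rewrite le2 ge2.
Qed.

Lemma post_feasible : feasible (problemP D) (post_process w).
Proof.
apply/problemP_feasibleP; split.
- by case=> // [p|g|f] _; apply: (qf_binary wP).
- exact: post_common_feasible.
- exact: post_dE.
- exact: post_chain_delay.
- by move=> g; have := qf_route_hop wP g; rewrite /holds /= xiE mulrA.
Qed.

End PostProcess.

(** * Transfer of optimality *)

Lemma optimal_value_eq : optimal_value (problemP D) = optimal_value (problemQ D).
Proof.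
(* The sets of attained costs coincide, which also covers infeasible programs and infima that are
   not attained. *)
rewrite /optimal_value; congr ereal_inf; apply/seteqP; split=> _ [z zF <-] /=.
  by exists (extend z (aux_of z)); first exact: extend_feasible.
exists (post_process z); first exact/post_feasible/problemQ_feasibleP.
by rewrite cost_post_process.
Qed.

Lemma optimal_extend z :
  optimal (problemP D) z -> optimal (problemQ D) (extend z (aux_of z)).
Proof.
move=> [zF zmin]; split; first exact: extend_feasible.
move=> w /problemQ_feasibleP/post_feasible/zmin.
by rewrite /= cost_post_process.
Qed.

Lemma optimal_post_process w :
  optimal (problemQ D) w -> optimal (problemP D) (post_process w).
Proof.
move=> [wF wmin]; split; first exact/post_feasible/problemQ_feasibleP.
by move=> z /extend_feasible/wmin; rewrite /= cost_post_process.
Qed.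

End Reformulation.

Theorem proposition1 (R : realType) (D : sfc_data R) :
  (* (i) *)
  [/\ miqcp (problemQ D),
      linear_fun (objective (problemQ D)),
      forall k, (constraints (problemQ D) `\` range (@cone_constr R D)) k ->
        linear_constr k,
      forall p : place D, constraints (problemQ D) (cone_constr p) &
      forall (p : place D) (w : qvar D -> R),
        (forall k, (constraints (problemQ D) `\` range (@cone_constr R D)) k ->
           holds k w) ->
        (holds (cone_constr p) w <->
         rotated_cone (w (inl (VD p))) (w (inr (VPi p))) (w (inr VC)))]
  (* (ii) *)
  /\ (optimal_value (problemP D) = optimal_value (problemQ D) /\
      forall z : pvar D -> R, optimal (problemP D) z ->
        exists a : qaux D -> R,
          optimal (problemQ D) (extend z a) /\
          ((forall w, optimal (problemQ D) w -> w = extend z a) \/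
           (exists w, optimal (problemQ D) w /\ w <> extend z a)))
  (* (iii) *)
  /\ (forall w : qvar D -> R, optimal (problemQ D) w ->
        optimal (problemP D) (post_process w)).
Proof.
split; last split; last exact: optimal_post_process.
  split.
  - split; [exact: problemQ_finite| |exact: problemQ_quadratic].
    exact/quadratic_linear/linear_fun_restrict/linear_cost.
  - exact/linear_fun_restrict/linear_cost.
  - by move=> k [/problemQ_linear_or_cone[|]].
  - by move=> p; in_union.
  - exact: problemQ_cone.
split; first exact: optimal_value_eq.
move=> z zO; exists (aux_of z); split; first exact: optimal_extend.
(* Unique or one of several: this alternative is excluded middle. *)
have [?|] := pselect (exists w, optimal (problemQ D) w /\ w <> extend z (aux_of z)).
  by right.
by move=> nex; left=> w wO; apply: contrapT => wz; apply: nex; exists w.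
Qed.
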